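(* Let $G$ be a graph of order $n$ with maximum degree $\Delta(G)=2$. Then $\mathcal{A}(G)\ge \mathcal{A}\big(K_{\chi(G)}\cup(n-\chi(G))K_1\big)$, with equality if and only if $G\simeq K_{\chi(G)}\cup (n-\chi(G))K_1$.
   Context: All graphs are finite, simple and undirected. A coloring of a graph $G$ assigns colors to its vertices so that adjacent vertices receive different colors; two colorings are equivalent if they induce the same partition of the vertex set into color classes. $S(G,k)$ denotes the number of non-equivalent colorings of $G$ using exactly $k$ colors. Set $\mathcal{B}(G)=\sum_{k\ge1}S(G,k)$, $\mathcal{T}(G)=\sum_{k\ge1}kS(G,k)$ and $\mathcal{A}(G)=\mathcal{T}(G)/\mathcal{B}(G)$. $\chi(G)$ is the chromatic number, $K_r$ the complete graph on $r$ vertices, $\cup$ disjoint union, and $pK_1$ denotes $p$ isolated vertices. *)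

(* Defs.v *)
From HB Require Import structures.
From mathcomp Require Import all_boot all_order all_algebra.

Set Implicit Arguments.
Unset Strict Implicit.
Unset Printing Implicit Defensive.

Import Order.TTheory GRing.Theory Num.Theory.

Record sgraph := SGraph {
  vertex :> finType;
  edge : rel vertex;
  edge_sym : symmetric edge;
  edge_irrefl : irreflexive edge }.

Definition isomorphic (G H : sgraph) : Prop :=
  exists2 f : G -> H, bijective f & {mono f : x y / edge x y}.

Definition degree (G : sgraph) (x : G) : nat := #|[set y | edge x y]|.

Definition max_degree (G : sgraph) : nat := \max_(x : G) degree x.

Section Coloring.
Variable G : sgraph.
Implicit Type k : nat.

Definition proper_coloring k (f : {ffun G -> 'I_k}) : bool :=
  [forall x, forall y, edge x y ==> (f x != f y)].

Definition uses_all k (f : {ffun G -> 'I_k}) : bool :=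
  [forall c, c \in codom f].

Definition color_classes k (f : {ffun G -> 'I_k}) : {set {set G}} :=
  preim_partition f [set: G].

(* Equivalence classes of colorings are counted through the
   partitions that they induce. *)
Definition num_colorings k : nat :=
  #|[set color_classes f | f in [set f : {ffun G -> 'I_k} |
                                 proper_coloring f && uses_all f]]|.

Lemma num_colorings_gt_order k : #|G| < k -> num_colorings k = 0.
Proof.
move=> ltGk; rewrite /num_colorings; apply/eqP; rewrite cards_eq0 -subset0.
apply/subsetP=> P /imsetP[f]; rewrite inE => /andP[_ /forallP f_onto] _.
have : #|'I_k| <= #|codom f| by apply/subset_leq_card/subsetP=> c _; apply: f_onto.
by rewrite card_ord => /leq_trans/(_ (card_size _)); rewrite size_codom leqNgt ltGk.
Qed.

(* The sums over all k >= 1 stop at the order of G, by num_colorings_gt_order. *)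
Definition num_all_colorings : nat := \sum_(1 <= k < #|G|.+1) num_colorings k.

Definition num_all_colors : nat := \sum_(1 <= k < #|G|.+1) k * num_colorings k.

Definition average : rat := (num_all_colors%:R / num_all_colorings%:R)%R.

Definition colorable k : bool :=
  [exists f : {ffun G -> 'I_k}, proper_coloring f].

Lemma ex_colorable : exists k, colorable k.
Proof.
exists #|G|; apply/existsP; exists [ffun x => enum_rank x].
apply/forallP=> x; apply/forallP=> y; apply/implyP=> xy; rewrite !ffunE.
by apply: contraTneq xy => /enum_rank_inj->; rewrite edge_irrefl.
Qed.

Definition chromatic_number : nat := ex_minn ex_colorable.

End Coloring.

Section Constructions.

Definition complete_edge r : rel 'I_r := fun i j => i != j.

Lemma complete_edge_sym r : symmetric (@complete_edge r).
Proof. by move=> i j; rewrite /complete_edge eq_sym. Qed.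

Lemma complete_edge_irrefl r : irreflexive (@complete_edge r).
Proof. by move=> i; rewrite /complete_edge eqxx. Qed.

Definition complete r : sgraph :=
  SGraph (@complete_edge_sym r) (@complete_edge_irrefl r).

Definition no_edge p : rel 'I_p := fun _ _ => false.

Lemma no_edge_sym p : symmetric (@no_edge p).
Proof. by []. Qed.

Lemma no_edge_irrefl p : irreflexive (@no_edge p).
Proof. by []. Qed.

Definition isolated p : sgraph :=
  SGraph (@no_edge_sym p) (@no_edge_irrefl p).

Variables G H : sgraph.

Definition union_edge : rel (G + H)%type := fun u v =>
  match u, v with
  | inl x, inl y => edge x y
  | inr x, inr y => edge x y
  | _, _ => false
  end.

Lemma union_edge_sym : symmetric union_edge.
Proof. by move=> [x|x] [y|y] //=; rewrite edge_sym. Qed.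

Lemma union_edge_irrefl : irreflexive union_edge.
Proof. by move=> [x|x] /=; rewrite edge_irrefl. Qed.

Definition disjoint_union : sgraph :=
  SGraph union_edge_sym union_edge_irrefl.

End Constructions.

(* Main.v *)
Require Import Defs.
From HB Require Import structures.
From mathcomp Require Import all_boot all_order all_algebra.
From mathcomp Require Import zify ring lra.

Set Implicit Arguments.
Unset Strict Implicit.
Unset Printing Implicit Defensive.

Import Order.TTheory GRing.Theory Num.Theory.

(** The chromatic polynomial is [P_G x = \sum_k S(G, k) * x ^_ k], and all the
    factorial moments of a Poisson variable [X] of parameter 1 equal 1. Hence
    [B(G) = E (P_G X)] and [T(G) + B(G) = E (X * P_G X)], so that [A(G) + 1] is
    the mean of [X] weighted by [P_G]. If [P_G / P_H] increases on the support
    of [P_H], then [A(H) < A(G)], by Chebyshev's correlation inequality.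

    A graph of maximum degree at most 2 is a union of paths and cycles, split
    off one by one as longest paths. With [u = y / (y + 1)], [v = 1 / (y + 1)]
    and [x = y + 1], a component with [l] vertices contributes to [P_G x / x ^ n]
    the factor [u ^ (l - 1)] if it is a path, [u (u ^ (l - 1) - (- v) ^ (l - 1))]
    if it is a cycle; both increase with [y >= 1]. The factor of [K_2] is [u].
    That of [K_3] is [u (u - v)], and the factor of a longer odd cycle divided by it
    still increases for [y >= 2]. Hence [P_G / P_H] increases strictly,
    unless [G] is a triangle with isolated vertices. *)

(** * Averages as weighted Poisson means *)

Section Poisson.
Local Open Scope ring_scope.

Definition exp_sum N : rat := \sum_(i < N) (i`!)%:R^-1.

Lemma fact_ratr_gt0 n : 0 < (n`!)%:R :> rat.
Proof. by rewrite ltr0n fact_gt0. Qed.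

(** Since [i ^_ k / i! = 1 / (i - k)!], a factorial moment of the Poisson law truncated at [N] is a
    shorter partial sum of the series of e. *)
Lemma sum_ffact_div_fact k N :
  \sum_(i < N) (i ^_ k)%:R / (i`!)%:R = exp_sum (N - k).
Proof.
rewrite /exp_sum; elim: N => [|N IHN]; first by rewrite sub0n !big_ord0.
rewrite big_ord_recr /= IHN; case: (leqP k N) => [le_kN | lt_Nk].
  rewrite subSn // big_ord_recr /= -(ffact_fact le_kN) natrM.
  congr (_ + _); rewrite invfM mulrA divff ?mul1r //.
  by rewrite pnatr_eq0 -lt0n ffact_gt0.
by rewrite ffact_small // mul0r addr0;
  rewrite (eqP (ltnW lt_Nk : N - k == 0)%N) (eqP (lt_Nk : N.+1 - k == 0)%N).
Qed.

(** Each of the [j] additional terms lies between 0 and [1 / M!]. This crude tail bound keeps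
    everything rational, without the number e. *)
Lemma exp_sum_addn M j :
  exp_sum M <= exp_sum (M + j) <= exp_sum M + j%:R / (M`!)%:R.
Proof.
elim: j => [|j /andP[IH1 IH2]]; first by rewrite addn0 mul0r addr0 lexx.
have -> : exp_sum (M + j.+1) = exp_sum (M + j) + ((M + j)`!)%:R^-1.
  by rewrite addnS /exp_sum big_ord_recr.
have h0 := fact_ratr_gt0 (M + j).
have h1 : ((M + j)`!)%:R^-1 <= (M`!)%:R^-1 :> rat.
  rewrite lef_pV2 ?posrE ?fact_ratr_gt0 // ler_nat.
  by apply: leq_fact; apply: leq_addr.
have h2 : 0 <= ((M + j)`!)%:R^-1 :> rat by rewrite invr_ge0 ltW.
by rewrite -natr1 mulrDl mul1r; apply/andP; split; lra.
Qed.

(* Up to the factor exp 1, the sum of the [p.1] is the expectation of [f] under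
   the Poisson law of parameter 1, all of whose factorial moments equal 1. *)
Lemma poisson_bound (s : seq (rat * nat))
    (f := fun i : nat => \sum_(p <- s) p.1 * (i ^_ p.2)%:R) :
    (forall i, 0 <= f i) -> \sum_(p <- s) p.1 <= 0 ->
  forall i, f i / (i`!)%:R <= \sum_(p <- s) p.1.
Proof.
move=> f_ge0; set c := \sum_(p <- s) p.1 => c_le0 i.
(* [K] bounds every degree, so truncation at [M + K] turns each moment into a partial sum with at
   least [M] terms. The weights have signs, so the error is measured by absolute values. *)
pose K := (\max_(p <- s) p.2)%N.
pose C := (\sum_(p <- s) `|p.1|) * K%:R.
have C_ge0 : 0 <= C by rewrite mulr_ge0 ?ler0n // sumr_ge0.
(* A single term is at most the truncated expectation, which is controlled by [c] up to an error
   vanishing as [M] grows. *)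
have bound M : (i < M)%N -> f i / (i`!)%:R <= c + C / M%:R.
  move=> lt_iM; have M_gt0 : (0 < M)%N by apply: leq_ltn_trans lt_iM.
  have term_ge0 j : 0 <= f j / (j`!)%:R.
    by rewrite divr_ge0 // ltW ?fact_ratr_gt0.
  have lt_iMK : (i < M + K)%N by apply: leq_trans lt_iM (leq_addr _ _).
  have le1 : f i / (i`!)%:R <= \sum_(j < M + K) f j / (j`!)%:R.
    by rewrite (bigD1 (Ordinal lt_iMK)) //= lerDl sumr_ge0.
  have eq2 : \sum_(j < M + K) f j / (j`!)%:R
             = \sum_(p <- s) p.1 * exp_sum (M + K - p.2).
    under eq_bigr => j _ do rewrite /f mulr_suml.
    rewrite exchange_big; apply: eq_bigr => p _ /=.
    rewrite -sum_ffact_div_fact mulr_sumr.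
    by apply: eq_bigr => j _; rewrite mulrA.
  have le3 : \sum_(p <- s) p.1 * exp_sum (M + K - p.2)
             <= \sum_(p <- s) (p.1 * exp_sum M + `|p.1| * (K%:R / (M`!)%:R)).
    rewrite big_seq [leRHS]big_seq; apply: ler_sum => p ps.
    have le_pK : (p.2 <= K)%N by apply: (@leq_bigmax_seq _ s predT (fun q : rat * nat
      => q.2) p).
    rewrite -lerBlDl -mulrBr.
    rewrite (le_trans (ler_norm _)) // normrM ler_wpM2l //.
    have /andP[h1 h2] := exp_sum_addn M (K - p.2).
    rewrite addnBA // in h1 h2.
    rewrite ger0_norm ?subr_ge0 // lerBlDl (le_trans h2) // lerD2l.
    by rewrite ler_wpM2r ?invr_ge0 ?(ltW (fact_ratr_gt0 _)) // ler_nat leq_subr.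
  have eq4 : \sum_(p <- s) (p.1 * exp_sum M + `|p.1| * (K%:R / (M`!)%:R))
             = c * exp_sum M + C / (M`!)%:R.
    by rewrite big_split /= -!mulr_suml /C mulrA.
  have le5 : c * exp_sum M <= c.
    have : 1 <= exp_sum M.
      case: M M_gt0 {lt_iM lt_iMK le1 eq2 le3 eq4} => // M _.
      rewrite /exp_sum big_ord_recl /= invr1 lerDl sumr_ge0 // => j _.
      by rewrite invr_ge0 ltW ?fact_ratr_gt0.
    by move=> ?; nra.
  have le6 : C / (M`!)%:R <= C / M%:R.
    rewrite ler_wpM2l // lef_pV2 ?posrE ?fact_ratr_gt0 ?ltr0n //.
    rewrite ler_nat; case: M M_gt0 {lt_iM lt_iMK le1 eq2 le3 eq4 le5} => // M _.
    by rewrite factS leq_pmulr // fact_gt0.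
  rewrite eq2 in le1; apply: le_trans le1 (le_trans le3 _).
  by rewrite eq4 lerD.
rewrite leNgt; apply/negP; set a := f i / _; move=> lt_ca.
have d_gt0 : 0 < a - c by rewrite subr_gt0.
(* Large enough that [C / M < a - c], against the bound at [M]. *)
pose M := (i + (Num.bound (C / (a - c))).+1)%N.
have /bound : (i < M)%N by rewrite /M addnS ltnS leq_addr.
have M_gt0 : 0 < M%:R :> rat by rewrite ltr0n /M addnS.
rewrite -/a -lerBlDl ler_pdivlMr // leNgt => /negP[].
rewrite -ltr_pdivrMl // mulrC.
apply: lt_trans (archi_boundP _) _; first by rewrite divr_ge0 // ltW.
by rewrite ltr_nat /M addnS ltnS leq_addl.
Qed.

Lemma poisson_ge0 (s : seq (rat * nat)) :
    (forall i : nat, 0 <= \sum_(p <- s) p.1 * (i ^_ p.2)%:R) ->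
  0 <= \sum_(p <- s) p.1.
Proof.
move=> f_ge0; rewrite leNgt; apply/negP => s_lt0.
have := poisson_bound f_ge0 (ltW s_lt0) 0.
rewrite leNgt => /negP[]; apply: lt_le_trans s_lt0 _.
by rewrite divr_ge0 // ltW ?fact_ratr_gt0.
Qed.

Lemma poisson_gt0 (s : seq (rat * nat)) (i : nat) :
    (forall i : nat, 0 <= \sum_(p <- s) p.1 * (i ^_ p.2)%:R) ->
    0 < \sum_(p <- s) p.1 * (i ^_ p.2)%:R ->
  0 < \sum_(p <- s) p.1.
Proof.
move=> f_ge0 fi_gt0; rewrite ltNge; apply/negP => s_le0.
have := poisson_bound f_ge0 s_le0 i; rewrite leNgt => /negP[].
by apply: le_lt_trans s_le0 _; rewrite divr_gt0 ?fact_ratr_gt0.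
Qed.

End Poisson.

(** * The chromatic polynomial in the falling factorial basis *)

Definition num_proper (T : finType) (e : rel T) (x : nat) : nat :=
  #|[set f : {ffun T -> 'I_x} | [forall u, forall v, e u v ==> (f u != f v)]]|.

Section Expansion.
Variable G : sgraph.

Lemma color_classes_eqP j k (f : {ffun G -> 'I_j}) (g : {ffun G -> 'I_k}) :
  reflect (forall u v, (f u == f v) = (g u == g v))
          (color_classes f == color_classes g).
Proof.
apply: (iffP eqP) => [eq_fg u v | eq_fg]; last first.
  by apply/setP=> A; apply/imsetP/imsetP => -[x xT ->]; exists x => //;
     apply/setP=> y; rewrite !inE eq_fg.
have pbE i (h : {ffun G -> 'I_i}) a b :
    (b \in pblock (color_classes h) a) = (h a == h b).
  rewrite /color_classes /preim_partition pblock_equivalence_partition ?inE //.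
  by split=> // /eqP ->.
by rewrite -!pbE eq_fg.
Qed.

(** The colorings with the classes of [g] are exactly the compositions of [g] with an injection of
    its [k] colors into the [x] colors. *)
Lemma card_same_classes k (g : {ffun G -> 'I_k}) x : uses_all g ->
  #|[set f : {ffun G -> 'I_x} | color_classes f == color_classes g]| = x ^_ k.
Proof.
move=> /forallP g_onto.
pose inv c := iinv (g_onto c).
have gK c : g (inv c) = c by rewrite /inv f_iinv.
have -> : x ^_ k = #|[set h : {ffun 'I_k -> 'I_x} | injectiveb h]|.
  by rewrite card_inj_ffuns !card_ord.
pose comp (h : {ffun 'I_k -> 'I_x}) : {ffun G -> 'I_x} := [ffun v => h (g v)].
rewrite -(@card_imset _ _ comp); last first.
  move=> h1 h2 /ffunP eq_h; apply/ffunP=> c.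
  by have := eq_h (inv c); rewrite !ffunE gK.
apply: eq_card => f; rewrite inE; apply/color_classes_eqP/imsetP.
  move=> eq_fg; exists [ffun c => f (inv c)].
    rewrite inE; apply/injectiveP => c d; rewrite !ffunE => /eqP.
    by rewrite eq_fg !gK => /eqP.
  by apply/ffunP=> v; rewrite !ffunE; apply/eqP; rewrite eq_fg gK.
by move=> [h]; rewrite inE => /injectiveP h_inj -> u v; rewrite !ffunE inj_eq.
Qed.

Lemma eq_proper_coloring j k (f : {ffun G -> 'I_j}) (g : {ffun G -> 'I_k}) :
  (forall u v, (f u == f v) = (g u == g v)) ->
  proper_coloring f = proper_coloring g.
Proof.
by move=> fg; apply/eq_forallb => u; apply/eq_forallb => v; rewrite fg.
Qed.

Lemma uses_all_classes_inj j k (f : {ffun G -> 'I_j}) (g : {ffun G -> 'I_k}) :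
  uses_all f -> uses_all g -> color_classes f = color_classes g -> j = k.
Proof.
move=> f_onto g_onto /eqP/color_classes_eqP eq_fg.
have cardE i (h : {ffun G -> 'I_i}) : uses_all h -> #|codom h| = i.
  move=> /forallP h_onto; rewrite -[RHS]card_ord; apply: eq_card => c.
  by rewrite h_onto.
have le i i' (h : {ffun G -> 'I_i}) (h' : {ffun G -> 'I_i'}) : uses_all h ->
    uses_all h' -> (forall u v, (h u == h v) = (h' u == h' v)) -> i <= i'.
  move=> /forallP h_onto /forallP h'_onto eq_hh'.
  rewrite -[i]card_ord -[i']card_ord.
  apply: (@leq_card _ _ (fun c => h' (iinv (h_onto c)))) => c d /eqP.
  by rewrite -eq_hh' !f_iinv => /eqP.
by apply/eqP; rewrite eqn_leq (le _ _ f g) ?(le _ _ g f).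
Qed.

Lemma ex_onto_same_classes j (f : {ffun G -> 'I_j}) :
  exists k, exists2 g : {ffun G -> 'I_k},
    uses_all g & forall u v, (f u == f v) = (g u == g v).
Proof.
have in_im v : f v \in codom f by apply: codom_f.
exists #|codom f|.
exists [ffun v => enum_rank_in (in_im v) (f v)].
  apply/forallP => c.
  have /codomP[v def_c] := enum_valP c.
  apply/codomP; exists v; rewrite ffunE; apply: enum_val_inj.
  by rewrite enum_rankK_in.
move=> u v; rewrite !ffunE; apply/eqP/eqP => [eq_f | /(congr1 enum_val)].
  by apply: enum_val_inj; rewrite !enum_rankK_in.
by rewrite !enum_rankK_in.
Qed.

(** Proper colorings are grouped by the partition they induce. A partition arises from onto
    colorings for a single [k], and then its group has [x ^_ k] elements. *)
Lemma num_proper_expansion x :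
  num_proper (@edge G) x = \sum_(k < #|G|.+1) num_colorings G k * x ^_ k.
Proof.
pose onto k := [set color_classes f | f in [set f : {ffun G -> 'I_k} |
                  proper_coloring f && uses_all f]].
pose A := [set f : {ffun G -> 'I_x} | proper_coloring f].
have -> : num_proper (@edge G) x = #|A| by [].
have fiber P : #|[set f in A | color_classes f == P]|
               = \sum_(k < #|G|.+1) (P \in onto k) * x ^_ k.
  case: (boolP [exists k : 'I_#|G|.+1, P \in onto k]) => [/existsP[k Pk] | noP].
    have /imsetP[g] := Pk; rewrite inE => /andP[g_proper g_onto] defP.
    rewrite (bigD1 k) //= Pk mul1n big1 => [|j j'k]; last first.
      case: imsetP => // -[h]; rewrite inE => /andP[_ h_onto] defP'.
      have /val_inj eq_jk : j = k :> nat.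
        by apply: uses_all_classes_inj h_onto g_onto _; rewrite -defP'.
      by rewrite eq_jk eqxx in j'k.
    rewrite addn0 -(card_same_classes x g_onto); apply: eq_card => f.
    rewrite !inE defP; case: color_classes_eqP => [fg | _]; last exact: andbF.
    by rewrite (eq_proper_coloring fg) g_proper.
  rewrite big1 => [|k _]; last first.
    by move: noP; rewrite negb_exists => /forallP/(_ k)/negPf ->.
  apply: eq_card0 => f; rewrite !inE; apply/negP => /andP[f_proper /eqP defP].
  case/existsP: noP; have [k [g g_onto eq_fg]] := ex_onto_same_classes f.
  have P_onto : P \in onto k.
    apply/imsetP; exists g.
      by rewrite inE g_onto -(eq_proper_coloring eq_fg) f_proper.
    by rewrite -defP; apply/eqP/color_classes_eqP.
  have lt_kG : k < #|G|.+1.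
    rewrite ltnNge; apply/negP => /num_colorings_gt_order/eqP.
    by rewrite cards_eq0 => /eqP onto0; rewrite /onto onto0 inE in P_onto.
  by exists (Ordinal lt_kG).
transitivity (\sum_P #|[set f in A | color_classes f == P]|).
  rewrite -sum1_card (partition_big (fun f => color_classes f) predT) //=.
  by apply: eq_bigr => P _; rewrite sum1_card; apply: eq_card => f;
    rewrite [RHS]inE unfold_in.
under eq_bigr => P _ do rewrite fiber.
rewrite exchange_big; apply: eq_bigr => k _ /=.
have -> : num_colorings G k = \sum_(P in onto k) 1 by rewrite sum1_card.
rewrite -big_distrl [in RHS]big_mkcond /=; congr (_ * _).
Qed.

Lemma num_colorings0 : 0 < #|G| -> num_colorings G 0 = 0.
Proof.
move=> /card_gt0P[v _]; apply/eqP; rewrite cards_eq0 -subset0.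
by apply/subsetP => P /imsetP[f]; case: (f v).
Qed.

Local Open Scope ring_scope.

(* Weights of [a * (x - l) * num_proper G x] in the falling factorial basis. *)
Definition shifted_weights (a l : rat) : seq (rat * nat) :=
  [seq (a * (k%:R - l) * (num_colorings G k)%:R, k) | k <- iota 0 #|G|.+1] ++
  [seq (a * (num_colorings G k)%:R, k.+1) | k <- iota 0 #|G|.+1].

(** Multiplication by [x - l] in the falling factorial basis, from
    [x ^_ k.+1 = (x - k) * x ^_ k]. *)
Lemma ffactSr_shift (k x : nat) (l : rat) :
  (x%:R - l) * (x ^_ k)%:R = (k%:R - l) * (x ^_ k)%:R + (x ^_ k.+1)%:R.
Proof.
rewrite ffactnSr natrM; case: (leqP k x) => [le_kx | lt_xk].
  by rewrite natrB //; ring.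
by rewrite ffact_small // mul0r !mulr0 addr0.
Qed.

Lemma shifted_weights_eval a l x :
  \sum_(p <- shifted_weights a l) p.1 * (x ^_ p.2)%:R
  = a * (x%:R - l) * (num_proper (@edge G) x)%:R.
Proof.
rewrite num_proper_expansion natr_sum -(big_mkord xpredT (fun k =>
  ((num_colorings G k * x ^_ k)%N)%:R)) /index_iota subn0.
rewrite /shifted_weights; move: (iota 0 _) => r.
rewrite big_cat /= !big_map -big_split mulr_sumr; apply: eq_bigr => k _ /=.
have := ffactSr_shift k x l; rewrite natrM.
set s := (num_colorings G k)%:R; set u := (x ^_ k)%:R; set v := (x ^_ k.+1)%:R => E.
have -> : a * (x%:R - l) * (s * u) = a * s * ((x%:R - l) * u) by ring.
by rewrite E; ring.
Qed.

(** The weights in degree [k] give [T - l * B] and those in degree [k.+1] give another [B]. A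
    nonempty graph has no coloring with 0 colors, so sums from 0 and from 1 agree. *)
Lemma shifted_weights_sum a l : (0 < #|G|)%N ->
  \sum_(p <- shifted_weights a l) p.1
  = a * ((num_all_colors G)%:R + (1 - l) * (num_all_colorings G)%:R).
Proof.
move=> G_gt0; rewrite /num_all_colors /num_all_colorings /index_iota subn1 /=.
rewrite /shifted_weights big_cat /= !(big_map, big_cons) /= num_colorings0 //.
rewrite !mulr0 !add0r -big_split /= !natr_sum [in RHS]mulr_sumr -big_split
  mulr_sumr /=.
by apply: eq_bigr => k _; rewrite natrM; ring.
Qed.

Lemma num_all_colorings_gt0 x :
  (0 < #|G|)%N -> (0 < num_proper (@edge G) x)%N -> (0 < num_all_colorings G)%N.
Proof.
move=> G_gt0; rewrite !lt0n; apply: contraNneq.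
move/eqP; rewrite num_proper_expansion sum_nat_seq_eq0 => /allP S0.
rewrite big1 // => -[[|k] lt_kG] _ /=; first by rewrite num_colorings0.
have /S0 /= /eqP -> // : k.+1 \in index_iota 1 #|G|.+1 by rewrite mem_index_iota.
Qed.

End Expansion.

(** * Comparison of averages *)

Section Comparison.
Local Open Scope ring_scope.
Variables G H : sgraph.
Hypotheses (G_gt0 : (0 < #|G|)%N) (H_gt0 : (0 < #|H|)%N).

Let p x : rat := (num_proper (@edge G) x)%:R.
Let q x : rat := (num_proper (@edge H) x)%:R.
Let T K : rat := (num_all_colors K)%:R.
Let B K : rat := (num_all_colorings K)%:R.

(** Up to the factor e, [T G + (1 - l) * B G] is the Poisson expectation of [(x - l) * p x], so
    pointwise nonnegativity of the combination passes to the expectations. *)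
Lemma shifted_ge0 (a b l : rat) :
    (forall x : nat, 0 <= (x%:R - l) * (a * p x - b * q x)) ->
  0 <= a * (T G + (1 - l) * B G) - b * (T H + (1 - l) * B H).
Proof.
move=> pq_ge0; pose s := shifted_weights G a l ++ shifted_weights H (- b) l.
have -> : a * (T G + (1 - l) * B G) - b * (T H + (1 - l) * B H)
          = \sum_(w <- s) w.1.
  by rewrite big_cat /= !shifted_weights_sum //; rewrite mulNr.
apply: poisson_ge0 => x; rewrite big_cat /= !shifted_weights_eval.
by rewrite (_ : _ + _ = (x%:R - l) * (a * p x - b * q x)) // /p /q; ring.
Qed.

Lemma shifted_gt0 (a b l : rat) (i : nat) :
    (forall x : nat, 0 <= (x%:R - l) * (a * p x - b * q x)) ->
    0 < (i%:R - l) * (a * p i - b * q i) ->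
  0 < a * (T G + (1 - l) * B G) - b * (T H + (1 - l) * B H).
Proof.
move=> pq_ge0 pq_gt0; pose s := shifted_weights G a l ++ shifted_weights H (- b) l.
have -> : a * (T G + (1 - l) * B G) - b * (T H + (1 - l) * B H)
          = \sum_(w <- s) w.1.
  by rewrite big_cat /= !shifted_weights_sum //; rewrite mulNr.
have E x : \sum_(w <- s) w.1 * (x ^_ w.2)%:R = (x%:R - l) * (a * p x - b * q x).
  by rewrite big_cat /= !shifted_weights_eval /p /q; ring.
by apply: (@poisson_gt0 _ i) => [x|]; rewrite E.
Qed.

Lemma eq_average : p =1 q -> average G = average H.
Proof.
move=> eq_pq.
(* Equal weights of either sign turn the inequality into an equality; then [l = 1] isolates [T], and
   [l = 0] yields [B]. *)
have E l : T G + (1 - l) * B G = T H + (1 - l) * B H.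
  have h a : 0 <= a * (T G + (1 - l) * B G) - a * (T H + (1 - l) * B H).
    by apply: shifted_ge0 => x; rewrite eq_pq subrr mulr0.
  by have := h 1; have := h (-1); lra.
have ET := E 1; have EB := E 0; rewrite /average -/(T G) -/(T H) -/(B G) -/(B H).
have -> : T G = T H by lra.
by have -> : B G = B H by lra.
Qed.

(* Chebyshev's correlation inequality, in threshold form: for [l] the Poisson
   mean of [x] weighted by [q] and [m] next to [l], the function
   [(x - l) * (rho x - rho m) * q x] is nonnegative. *)
Lemma lt_average (rho : nat -> rat) (r : nat) :
    (forall x, (x < r)%N -> p x = 0 /\ q x = 0) ->
    (forall x, (r <= x)%N -> 0 < q x) ->
    (forall x, (r <= x)%N -> p x = q x * rho x) ->
    (forall x, (r <= x)%N -> 0 <= rho x) ->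
    (forall x, (r <= x)%N -> rho x < rho x.+1) ->
  average H < average G.
Proof.
move=> pq0 q_gt0 pE rho_ge0 rho_incr.
have rho_mono x y : (r <= x)%N -> (x <= y)%N -> rho x <= rho y.
  move=> le_rx /subnK <-; elim: (y - x)%N => [|d IHd] //.
  rewrite addSn (le_trans IHd) // ltW // rho_incr //.
  by rewrite (leq_trans le_rx) // leq_addl.
have BH_gt0 : 0 < B H.
  by rewrite ltr0n (@num_all_colorings_gt0 _ r) // -(ltr0n rat) q_gt0.
have BG_gt0 : 0 < B G.
  rewrite ltr0n (@num_all_colorings_gt0 _ r.+1) // -(ltr0n rat) -/(p _) pE //.
  by rewrite mulr_gt0 ?q_gt0 // (le_lt_trans (rho_ge0 r _)) ?rho_incr.
pose l := average H + 1.
have l_ge0 : 0 <= l by rewrite addr_ge0 ?divr_ge0 ?ler0n.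
(* By the choice of [l], the expectation of [(x - l) * q x] vanishes, so the term with [rho m] will
   drop out. *)
have ET : T H + (1 - l) * B H = 0.
  by rewrite /l /average -/(T H) -/(B H); field; rewrite gt_eqF.
(* From [r] on, [x < m] forces [x <= l] and [x > m] forces [x >= l]; hence [x - l] and
   [rho x - rho m] never have opposite signs. *)
pose m := maxn r (Num.trunc l).
have le_rm : (r <= m)%N by rewrite leq_maxl.
have sign x : (r <= x)%N -> 0 <= (x%:R - l) * (rho x - rho m).
  move=> le_rx; case: (ltngtP x m) => [lt_xm | lt_mx | ->].
  - have le_xl : x%:R <= l.
      rewrite -truncn_ge_nat //; move: lt_xm; rewrite /m.
      by rewrite leq_max ltnNge le_rx /= => /ltnW.
    rewrite mulr_le0 // ?subr_le0 //; apply: rho_mono => //; exact: ltnW.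
  - have le_lx : l <= x%:R.
      apply/ltW/(lt_le_trans (truncnS_gt _)); rewrite ler_nat.
      by apply: leq_ltn_trans lt_mx; rewrite leq_maxr.
    rewrite mulr_ge0 // ?subr_ge0 //; apply: rho_mono => //; exact: ltnW.
  - by rewrite subrr mulr0.
have f_E x : (r <= x)%N ->
    (x%:R - l) * (1 * p x - rho m * q x) = (x%:R - l) * (rho x - rho m) * q x.
  by move=> /pE ->; ring.
have : 0 < 1 * (T G + (1 - l) * B G) - rho m * (T H + (1 - l) * B H).
  apply: (@shifted_gt0 _ _ _ m.+1) => [x|].
    case: (leqP r x) => [le_rx | /pq0[-> ->]]; last lra.
    by rewrite f_E // mulr_ge0 ?sign // ltW ?q_gt0.
  rewrite f_E ?(leq_trans le_rm) // mulr_gt0 ?q_gt0 ?(leq_trans le_rm) //.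
  rewrite mulr_gt0 // subr_gt0 ?rho_incr //.
  by apply: lt_le_trans (truncnS_gt _) _; rewrite ler_nat ltnS leq_maxr.
(* What remains, [0 < T G + (1 - l) * B G], says that [l - 1], the average of [H], is less than that
   of [G]. *)
rewrite ET mulr0 subr0 mul1r {2}/average -/(T G) -/(B G) ltr_pdivlMr // /l.
lra.
Qed.

End Comparison.

(** * Paths and cycles *)

Section CountingAlongPaths.
Variables (T : finType) (y : nat).
Local Notation coloring := {ffun T -> 'I_y.+1}.
Implicit Types (f g : coloring) (phi : pred coloring) (v : T) (s t : seq T).

(** The condition [phi] ignores the colors on [t]. It will be properness off a component [t]. *)
Definition indep_on t phi := forall f g, {in [predC t], f =1 g} -> phi f = phi g.

Lemma indep_on_cons v s phi : indep_on (v :: s) phi -> indep_on s phi.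
Proof.
move=> phi_t f g eq_fg; apply: phi_t => u; rewrite !inE negb_or => /andP[_ us].
exact: eq_fg.
Qed.

(** Double counting of pairs of a coloring and a spare color: the involution [swap] exchanges the
    spare color with that of [v], on which neither [phi] nor [psi] depends. *)
Lemma card_fiber v k phi (psi : coloring -> pred 'I_y.+1) :
    (forall f g, {in predC1 v, f =1 g} -> phi f = phi g /\ psi f =1 psi g) ->
    (forall f, phi f -> #|psi f| = k) ->
  y.+1 * #|[set f | phi f && psi f (f v)]| = k * #|[set f | phi f]|.
Proof.
move=> indep card_psi.
pose upd f c : coloring := [ffun u => if u == v then c else f u].
pose swap (p : coloring * 'I_y.+1) := (upd p.1 p.2, p.1 v).
have swapK : involutive swap.
  move=> [f c]; congr (_, _) => /=; last by rewrite ffunE eqxx.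
  by apply/ffunP=> u; rewrite !ffunE; case: eqP => // ->.
have indep_upd f c : phi (upd f c) = phi f /\ psi (upd f c) =1 psi f.
  by apply: indep => u /=; rewrite inE ffunE => /negPf ->.
transitivity (\sum_(p : coloring * 'I_y.+1) (phi p.1 && psi p.1 (p.1 v))).
  rewrite -(pair_bigA _ (fun f (c : 'I_y.+1) => (phi f && psi f (f v) : nat))) /=.
  under eq_bigr => f _ do rewrite sum_nat_const card_ord.
  rewrite -big_distrr -sum1_card [in LHS]big_mkcond /=; congr (_ * _).
  by apply: eq_bigr => f _; rewrite inE; case: (_ && _).
rewrite (reindex_inj (inv_inj swapK)) /=.
rewrite -(pair_bigA _ (fun f c =>
  (phi (upd f c) && psi (upd f c) (upd f c v) : nat))) /=.
rewrite -sum1_card big_distrr [in RHS]big_mkcond /=; apply: eq_bigr => f _.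
rewrite inE muln1; case: ifP => phi_f; last first.
  by rewrite big1 // => c _; rewrite (indep_upd f c).1 phi_f.
rewrite -(card_psi f phi_f) -sum1_card [RHS]big_mkcond; apply: eq_bigr => c _ /=.
by rewrite (indep_upd f c).1 (indep_upd f c).2 phi_f ffunE eqxx unfold_in;
  case: (psi f c).
Qed.

Definition neq_under f : rel T := fun a b => f a != f b.

Lemma eq_path_neq f g v s : {in v :: s, f =1 g} ->
  path (neq_under f) v s = path (neq_under g) v s.
Proof.
elim: s v => //= w s IHs v eq_fg; rewrite IHs => [|u us]; last first.
  by apply: eq_fg; rewrite inE us orbT.
by rewrite /neq_under !eq_fg // !inE eqxx ?orbT.
Qed.

Definition path_count phi v s := #|[set f | phi f && path (neq_under f) v s]|.

Definition cycle_count phi v s :=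
  #|[set f | [&& phi f, path (neq_under f) v s & f v != f (last v s)]]|.

Lemma path_count_cons phi v w s : uniq [:: v, w & s] -> indep_on [:: v, w & s] phi ->
  y.+1 * path_count phi v (w :: s) = y * path_count phi w s.
Proof.
move=> /andP[v_ws _] phi_t.
pose Phi f := phi f && path (neq_under f) w s.
pose psi f : pred 'I_y.+1 := [pred c | c != f w].
rewrite /path_count -(@card_fiber v y Phi psi) => [|f g eq_fg | f _].
- congr (_ * _); apply: eq_card => f; rewrite !inE /Phi /= -andbA.
  by congr (_ && _); exact: andbC.
- have eq_ws : {in w :: s, f =1 g}.
    by move=> u u_ws; apply: eq_fg; apply: contraNneq v_ws => <-.
  split=> [|c]; last by rewrite /psi /= eq_ws ?mem_head.
  rewrite /Phi (eq_path_neq eq_ws); congr (_ && _); apply: phi_t => u.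
  by rewrite !inE negb_or => /andP[uv _]; apply: eq_fg.
- by rewrite (cardC1 (f w)) card_ord.
Qed.

(** Deletion and contraction of the closing edge: a coloring of the path either separates its ends,
    or gives [v] the color of the last vertex and thus colors the cycle on [w :: s]. In the latter
    count [v] is free, whence the factor [y.+1] on the other terms. *)
Lemma cycle_count_cons phi v w s : uniq [:: v, w & s] -> indep_on [:: v, w & s] phi ->
  y.+1 * cycle_count phi v (w :: s) + cycle_count phi w s
  = y.+1 * path_count phi v (w :: s).
Proof.
move=> /andP[v_ws _] phi_t.
pose Phi f := [&& phi f, path (neq_under f) w s & f w != f (last w s)].
pose psi f : pred 'I_y.+1 := [pred c | c == f (last w s)].
rewrite -[cycle_count phi w s]mul1n {2}/cycle_count.
rewrite -(@card_fiber v 1 Phi psi) => [|f g eq_fg | f _].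
- rewrite -mulnDr /path_count /cycle_count; congr (_ * _).
  set A := [set f | _ & path _ v _].
  rewrite -(cardsID [set f : coloring | f v == f (last w s)] A) addnC.
  congr (_ + _); apply: eq_card => f; rewrite !inE /Phi /=; last first.
    by rewrite [RHS]andbC -!andbA.
  rewrite /psi /=; case: (eqVneq (f v)) => [fv | _]; rewrite ?andbF ?andbT //.
  congr (_ && _).
  by rewrite {2}/neq_under fv andbC [in LHS]eq_sym.
- have eq_ws : {in w :: s, f =1 g}.
    by move=> u u_ws; apply: eq_fg; apply: contraNneq v_ws => <-.
  split=> [|c]; last by rewrite /psi /= eq_ws ?mem_last.
  rewrite /Phi (eq_path_neq eq_ws) !eq_ws ?mem_head ?mem_last //.
  congr (_ && _); apply: phi_t => u.
  by rewrite !inE negb_or => /andP[uv _]; apply: eq_fg.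
- by rewrite (card1 (f (last w s))).
Qed.

Local Open Scope ring_scope.

Let u : rat := y%:R / y.+1%:R.
Let v0 : rat := y.+1%:R^-1.

Lemma path_countE phi v s : uniq (v :: s) -> indep_on (v :: s) phi ->
  (path_count phi v s)%:R = u ^+ size s * #|[set f | phi f]|%:R.
Proof.
elim: s v => [|w s IHs] v t_uniq phi_t.
  by rewrite mul1r; congr _%:R; apply: eq_card => f; rewrite !inE andbT.
have /(congr1 (fun k => k%:R : rat)) := path_count_cons t_uniq phi_t.
have ws_uniq : uniq (w :: s) by case/andP: t_uniq.
rewrite !natrM (IHs w ws_uniq (indep_on_cons phi_t)) /= exprS => E.
apply: (@mulfI _ y.+1%:R); rewrite ?pnatr_eq0 // E /u.
by field; rewrite addrC natr1 pnatr_eq0.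
Qed.

(** For [l] vertices the factor is the chromatic polynomial [y ^ l + (-1) ^ l * y] of a cycle,
    divided by [(y + 1) ^ l]. One vertex counts as a loop and gives 0, which starts the
    recurrence. *)
Lemma cycle_countE phi v s : uniq (v :: s) -> indep_on (v :: s) phi ->
  (cycle_count phi v s)%:R
  = u * (u ^+ size s - (- v0) ^+ size s) * #|[set f | phi f]|%:R.
Proof.
elim: s v => [|w s IHs] v t_uniq phi_t.
  rewrite subrr mulr0 mul0r; apply/eqP; rewrite pnatr_eq0 cards_eq0.
  by apply/eqP/setP=> f; rewrite !inE /= eqxx andbF.
have /(congr1 (fun k => k%:R : rat)) := cycle_count_cons t_uniq phi_t.
have ws_uniq : uniq (w :: s) by case/andP: t_uniq.
rewrite natrD !natrM (path_countE t_uniq phi_t) (IHs w ws_uniq (indep_on_cons phi_t)).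
move=> /(canRL (addrK _)) E; apply: (@mulfI _ y.+1%:R); rewrite ?pnatr_eq0 // E.
rewrite /= !exprS /u /v0; set a := _ ^+ size s; set b := _ ^+ size s.
rewrite -(natr1 y); field.
by rewrite natr1 pnatr_eq0.
Qed.

End CountingAlongPaths.

(** * Components of graphs of maximum degree at most 2 *)

Section Components.
Variables (T : finType) (e : rel T).
Hypotheses (e_sym : symmetric e) (e_irr : irreflexive e).
Hypothesis deg_le2 : forall v, #|[set w | e v w]| <= 2.

Lemma no_three_neighbors a b c d : e a b -> e a c -> e a d -> ~~ uniq [:: b; c; d].
Proof.
move=> ab ac ad; apply/negP => bcd; have := deg_le2 a; rewrite leqNgt => /negP[].
have <- : #|[:: b; c; d]| = 3 by apply/card_uniqP.
apply: subset_leq_card.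
by apply/subsetP => w; rewrite !inE => /or3P[] /eqP ->.
Qed.

Lemma ex_longest_path v0 s0 : uniq (v0 :: s0) -> path e v0 s0 ->
  exists v s, [/\ uniq (v :: s), path e v s &
    forall v' s', uniq (v' :: s') -> path e v' s' -> size s' <= size s].
Proof.
move=> uniq0 path0.
pose P m := [exists t : m.+1.-tuple T, uniq t && sorted e t].
have Psize v s : uniq (v :: s) -> path e v s -> P (size s).
  by move=> us ps; apply/existsP; exists (in_tuple (v :: s)); rewrite us.
have exP : exists m, P m by exists (size s0); apply: (@Psize v0).
have leP m : P m -> m <= #|T|.
  move=> /existsP[t /andP[/card_uniqP tE _]].
  by have := max_card (mem t); rewrite tE size_tuple => /ltnW.
case: (ex_maxnP exP leP) => m /existsP[t /andP[ut st]] max_m.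
case: (tupleP t) ut st => v s ut st; exists v, s; split=> //.
by move=> v' s' us' ps'; rewrite (size_tuple s); apply: max_m (Psize v' s' us' ps').
Qed.

Section LongestPath.
Variables (v : T) (s : seq T).
Hypotheses (t_uniq : uniq (v :: s)) (t_path : path e v s).
Hypothesis t_longest :
  forall v' s', uniq (v' :: s') -> path e v' s' -> size s' <= size s.
Local Notation t := (v :: s).
Local Notation nth_t i := (nth v t i).

Lemma path_edge i : i < size s -> e (nth_t i) (nth_t i.+1).
Proof. by move=> lt_is; have /pathP := t_path => /(_ v i lt_is). Qed.

Lemma path_nth_eq i j : i <= size s -> j <= size s -> (nth_t i == nth_t j) = (i == j).
Proof. by move=> le_i le_j; rewrite nth_uniq. Qed.

(** A neighbor outside [t] would prolong the path if attached to an end, and would be a third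
    neighbor if attached to an inner vertex. *)
Lemma longest_path_closed a b : e a b -> (a \in t) = (b \in t).
Proof.
have closed a' b' : e a' b' -> a' \in t -> b' \in t.
  move=> ab /(nthP v)[i lt_it def_a]; have le_it : i <= size s by [].
  rewrite -def_a in ab.
  apply: contraT => b_t.
  case: (posnP i) => [i0 | i_gt0].
    have := @t_longest b' t; rewrite cons_uniq b_t t_uniq /= e_sym.
    by move: ab; rewrite i0 /= => -> /(_ isT t_path); rewrite ltnn.
  move: le_it; rewrite leq_eqVlt => /orP[/eqP i_last | lt_is].
    have := @t_longest v (rcons s b'); rewrite -rcons_cons rcons_uniq b_t t_uniq.
    rewrite rcons_path t_path size_rcons ltnn (last_nth v) -i_last.
    by move: ab; case: i i_gt0 {lt_it def_a i_last} => //= i _ -> /(_ isT isT).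
  have e1 := path_edge lt_is; have le_is := ltnW lt_is.
  have e2 : e (nth_t i) (nth_t i.-1).
    by rewrite e_sym -{2}(prednK i_gt0) path_edge // prednK.
  have := no_three_neighbors e1 e2 ab; rewrite /uniq !inE andbT.
  rewrite path_nth_eq ?(leq_trans (leq_pred _)) //.
  have nth_neq j : j <= size s -> (nth_t j == b') = false.
    by move=> le_j; apply: contraNF b_t => /eqP <-; rewrite mem_nth.
  rewrite !nth_neq ?(leq_trans (leq_pred _)) //= orbF andbT negbK.
  by move/eqP; case: i i_gt0 {lt_it le_is lt_is e1 e2 def_a ab} => //= i _; lia.
by move=> ab; apply/idP/idP; apply: closed => //; rewrite e_sym.
Qed.

(** If the edge is not a step of the path, an inner vertex at either of its ends would have three
    neighbors; so it joins the two ends of the path. *)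
Lemma longest_path_chord i j : i < j -> j <= size s -> e (nth_t i) (nth_t j) ->
  j = i.+1 \/ i = 0 /\ j = size s.
Proof.
move=> lt_ij le_js eij; case: (eqVneq j i.+1) => [|j_i1]; [by left | right].
have lt_i1j : i.+1 < j by rewrite ltn_neqAle eq_sym j_i1.
have lt_is : i < size s by apply: leq_trans le_js.
split.
  apply/eqP; rewrite -leqn0 leqNgt; apply/negP => i_gt0.
  have e1 : e (nth_t i) (nth_t i.-1).
    by rewrite e_sym -{2}(prednK i_gt0) path_edge // prednK // ltnW.
  have := no_three_neighbors e1 (path_edge lt_is) eij.
  rewrite /uniq !inE !path_nth_eq //; try by lia.
  by rewrite in_nil; lia.
apply/eqP; rewrite eqn_leq le_js leqNgt; apply/negP => lt_js.
have j_gt0 : 0 < j by lia.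
have e1 : e (nth_t j) (nth_t j.-1).
  by rewrite e_sym -{2}(prednK j_gt0) path_edge // prednK // ltnW.
rewrite e_sym in eij.
have := no_three_neighbors e1 (path_edge lt_js) eij.
rewrite /uniq !inE !path_nth_eq //; try by lia.
by rewrite in_nil; lia.
Qed.

End LongestPath.
End Components.

(** The vertices of [t] remain, now isolated. The vertex type never changes, which is why colorings
    are counted for a bare relation. *)
Definition edges_off (T : finType) (e : rel T) (t : seq T) : rel T :=
  [rel a b | [&& e a b, a \notin t & b \notin t]].

(** * Splitting off a component *)

Section Density.
Local Open Scope ring_scope.

Definition up (y : nat) : rat := y%:R / y.+1%:R.
Definition vp (y : nat) : rat := y.+1%:R^-1.

(** A component is encoded by whether it is a cycle and by its number of vertices. *)
Definition factor (c : bool * nat) (y : nat) : rat :=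
  if c.1 then up y * (up y ^+ c.2.-1 - (- vp y) ^+ c.2.-1) else up y ^+ c.2.-1.

(** The probability that a uniformly random coloring with [y.+1] colors is proper; isolated vertices
    do not affect it. *)
Definition proper_density (T : finType) (e : rel T) (y : nat) : rat :=
  (num_proper e y.+1)%:R / y.+1%:R ^+ #|T|.

(** A longest path spans its component. The given path only guarantees a minimal length. The
    condition [1 < size s] prevents a single edge from passing for a cycle. *)
Lemma ex_component (T : finType) (e : rel T) (v0 : T) (s0 : seq T) :
    symmetric e -> irreflexive e -> (forall v, (#|[set w | e v w]| <= 2)%N) ->
    uniq (v0 :: s0) -> path e v0 s0 ->
  exists v s, let b := (1 < size s)%N && e v (last v s) in
    [/\ uniq (v :: s), path e v s, (size s0 <= size s)%N,
        (forall a b, e a b -> (a \in v :: s) = (b \in v :: s)) &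
        forall y, proper_density e y = factor (b,
          (size s).+1) y * proper_density (edges_off e (v :: s)) y].
Proof.
move=> e_sym e_irr deg_le2 uniq0 path0.
have [v [s [us ps max_s]]] := ex_longest_path uniq0 path0.
have closed := longest_path_closed e_sym deg_le2 us ps max_s.
exists v, s => b; split=> //; first exact: max_s path0.
move=> y; pose t := v :: s.
pose proper (e' : rel T) (f : {ffun T -> 'I_y.+1}) :=
  [forall a, forall b, e' a b ==> (f a != f b)].
pose phi := proper (edges_off e t).
have phi_t : indep_on t phi.
  move=> f g eq_fg; apply: eq_forallb => a; apply: eq_forallb => a' /=.
  rewrite /edges_off/=.
  case: (boolP (a \in t)) => at_; first by rewrite /= andbF.
  case: (boolP (a' \in t)) => a't; first by rewrite /= !andbF.
  by rewrite !eq_fg // inE.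
(* By closedness and the chord lemma, the edges are those off [t], the steps of the path, and
   possibly the closing edge. *)
have properE f : proper e f =
    [&& phi f, path (neq_under f) v s & b ==> (f v != f (last v s))].
  apply/idP/and3P => [f_proper | [phi_f path_f last_f]].
    have fe a a' : e a a' -> f a != f a'.
      by move: f_proper => /forallP/(_ a)/forallP/(_ a')/implyP.
    split; first 1 last.
    - by apply: sub_path ps; exact: fe.
    - by apply/implyP => /andP[_]; apply: fe.
    by apply/forallP => a; apply/forallP => a'; apply/implyP => /and3P[/fe].
  have f_nth i j : (i < j)%N -> (j <= size s)%N -> e (nth v t i) (nth v t j) ->
      f (nth v t i) != f (nth v t j).
    move=> lt_ij le_js eij.
    have [j_i1 | [i0 j_s]] := longest_path_chord e_sym deg_le2 us ps lt_ij le_js eij.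
      by rewrite j_i1; have /pathP := path_f => /(_ v i); apply;
        rewrite -j_i1 in le_js *.
    case: (ltnP 1 (size s)) => [lt_1s | le_s1].
      move: last_f; rewrite /b lt_1s (last_nth v) /=; move: eij; rewrite i0 j_s /=.
      by rewrite -/t => ->.
    (* On a path with two vertices, the edge joining the ends is the only step. *)
    have j1 : j = 1%N by apply/eqP; rewrite eqn_leq {1}j_s le_s1 (leq_trans _ lt_ij).
    rewrite j1 i0; have /pathP := path_f => /(_ v 0%N); apply.
    by rewrite -j_s j1.
  apply/forallP => a; apply/forallP => a'; apply/implyP => aa'.
  case: (boolP (a \in t)) => at_; last first.
    move: phi_f => /forallP/(_ a)/forallP/(_ a')/implyP; apply.
    by rewrite /edges_off /= aa' at_ -(closed _ _ aa').
  have a't : a' \in t by rewrite -(closed _ _ aa').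
  have /(nthP v)[i lt_it def_a] := at_; have /(nthP v)[j lt_jt def_a'] := a't.
  rewrite -def_a -def_a' in aa' *; case: (ltngtP i j) => [lt_ij | lt_ji | eq_ij].
  - exact: f_nth.
  - by rewrite eq_sym; apply: f_nth; rewrite // e_sym.
  - by rewrite eq_ij e_irr in aa'.
rewrite /proper_density mulrA; congr (_ / _).
have -> : num_proper e y.+1 = if b then cycle_count phi v s else path_count phi v s.
  rewrite /num_proper /cycle_count /path_count.
  by case: b properE => properE; apply: eq_card => f;
    rewrite !inE -[LHS]/(proper e f) properE ?andbT.
rewrite /factor /=; case: b {properE}; first exact: cycle_countE.
exact: path_countE.
Qed.

End Density.

(** * Monotonicity of the factors *)

Section Factorization.
Local Open Scope ring_scope.

Definition valid_factor (c : bool * nat) := ((1 < c.2) && (c.1 ==> (2 < c.2)))%N.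

Lemma edges_off_lt (T : finType) (e : rel T) (t : seq T) a b :
    e a b -> a \in t ->
  (#|[set p | edges_off e t p.1 p.2]| < #|[set p | e p.1 p.2]|)%N.
Proof.
move=> ab at_; apply/proper_card/properP; split.
  by apply/subsetP => -[c d]; rewrite !inE => /and3P[].
by exists (a, b); rewrite inE /edges_off /= ?at_ ?andbF.
Qed.

Lemma edges_off_sym (T : finType) (e : rel T) (t : seq T) :
  symmetric e -> symmetric (edges_off e t).
Proof. by move=> e_sym a b; rewrite /edges_off /= e_sym [X in _ && X]andbC. Qed.

Lemma edges_off_irr (T : finType) (e : rel T) (t : seq T) :
  irreflexive e -> irreflexive (edges_off e t).
Proof. by move=> e_irr a; rewrite /edges_off /= e_irr. Qed.

Lemma edges_off_deg (T : finType) (e : rel T) (t : seq T) d :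
    (forall v, (#|[set w | e v w]| <= d)%N) ->
  forall v, (#|[set w | edges_off e t v w]| <= d)%N.
Proof.
move=> deg v; apply: leq_trans (deg v); apply: subset_leq_card.
by apply/subsetP => w; rewrite !inE => /and3P[].
Qed.

Lemma density_no_edge (T : finType) (e : rel T) y :
  (forall a b, e a b = false) -> proper_density e y = 1.
Proof.
move=> e0; have -> : proper_density e y = y.+1%:R ^+ #|T| / y.+1%:R ^+ #|T|.
  rewrite /proper_density; congr (_ / _); rewrite -natrX; congr _%:R.
  rewrite -[y.+1 in RHS]card_ord -card_ffun -cardsT; apply: eq_card => f.
  by rewrite !inE; apply/forallP => a; apply/forallP => b; rewrite e0.
by rewrite divff // expf_neq0 // pnatr_eq0.
Qed.

(** Induction on the number of adjacent ordered pairs, splitting off one component with an edge at a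
    time. The last clause serves to recognize the extremal graph. *)
Lemma ex_factors (T : finType) (e : rel T) :
    symmetric e -> irreflexive e -> (forall v, (#|[set w | e v w]| <= 2)%N) ->
  exists cs, [/\ all valid_factor cs,
    forall y, proper_density e y = \prod_(c <- cs) factor c y &
    cs = [::] -> forall a b, e a b = false].
Proof.
have [m] := ubnP #|[set p | e p.1 p.2]|; elim: m e => // m IHm e le_em.
move=> e_sym e_irr e_deg.
case: (boolP [exists a, exists b, e a b]) => [/existsP[a /existsP[b ab]] | no_edge].
  have uniq0 : uniq (a :: [:: b]).
    by rewrite /= inE andbT; apply: contraTneq ab => ->; rewrite e_irr.
  have path0 : path e a [:: b] by rewrite /= ab.
  have [v [s [us ps lt_s closed densityE]]] :=
    ex_component e_sym e_irr e_deg uniq0 path0.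
  have [] := IHm (edges_off e (v :: s)).
  - rewrite -ltnS; apply: leq_trans _ le_em; rewrite ltnS.
    case: s ps lt_s {us closed densityE} => //= w s /andP[vw _] _.
    by apply: edges_off_lt vw _; rewrite mem_head.
  - exact: edges_off_sym.
  - exact: edges_off_irr.
  - exact: edges_off_deg.
  move=> cs [cs_valid csE _]; eexists (_ :: cs); split=> [|y|] //=; last first.
    by rewrite big_cons densityE csE.
  rewrite cs_valid andbT /valid_factor /=; apply/andP; split=> //.
  by apply/implyP => /andP[].
have e0 a b : e a b = false.
  apply: contraNF no_edge => ab; apply/existsP; exists a.
  by apply/existsP; exists b.
by exists [::]; split=> // y; rewrite big_nil density_no_edge.
Qed.

End Factorization.

Section Monotonicity.
Local Open Scope ring_scope.
Implicit Types (g h : nat -> rat) (y m k l : nat).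

(** Positivity is required only after [m], because the factor of an odd cycle vanishes at [y = 1];
    it suffices to keep products strictly increasing. *)
Definition nondecr m g :=
  forall y, (m <= y)%N -> [/\ 0 <= g y, g y <= g y.+1 & 0 < g y.+1].

Definition incr m g := forall y, (m <= y)%N -> 0 <= g y /\ g y < g y.+1.

Lemma incrW m g : incr m g -> nondecr m g.
Proof. by move=> g_incr y /g_incr[g0 gy]; split=> //;
  [exact: ltW | exact: le_lt_trans gy]. Qed.

Lemma incr_from m k g : (m <= k)%N -> incr m g -> incr k g.
Proof. by move=> le_mk g_incr y le_ky; apply: g_incr; apply: leq_trans le_ky. Qed.

Lemma nondecr_from m k g : (m <= k)%N -> nondecr m g -> nondecr k g.
Proof. by move=> le_mk g_incr y le_ky; apply: g_incr; apply: leq_trans le_ky. Qed.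

Lemma nondecr1 m : nondecr m (fun=> 1).
Proof. by []. Qed.

Lemma nondecrM m g h : nondecr m g -> nondecr m h -> nondecr m (fun y => g y * h y).
Proof.
move=> g_nd h_nd y le_my; have [g0 g1 g2] := g_nd y le_my;
  have [h0 h1 h2] := h_nd y le_my.
by split; [exact: mulr_ge0 | exact: ler_pM | exact: mulr_gt0].
Qed.

Lemma nondecr_incrM m g h : nondecr m g -> incr m h -> incr m (fun y => g y * h y).
Proof.
move=> g_nd h_nd y le_my; have [g0 g1 g2] := g_nd y le_my; have [h0 h1] := h_nd y le_my.
split; first exact: mulr_ge0.
apply: le_lt_trans (_ : g y.+1 * h y < _); first exact: ler_wpM2r.
by rewrite ltr_pM2l.
Qed.

Lemma vp_gt0 y : 0 < vp y.
Proof. by rewrite invr_gt0 ltr0n. Qed.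

Lemma up_vp y : up y = 1 - vp y.
Proof.
rewrite /up /vp -natr1; field.
by rewrite natr1 pnatr_eq0.
Qed.

Lemma vp_decr y : vp y.+1 < vp y.
Proof. by rewrite ltf_pV2 ?posrE ?ltr0n // ltr_nat. Qed.

Lemma vp_le y : (0 < y)%N -> vp y <= 1 / 2.
Proof. by move=> y_gt0; rewrite mul1r lef_pV2 ?posrE ?ltr0n // ler_nat. Qed.

Lemma up_incr : incr 0 up.
Proof.
move=> y _; split; first by rewrite divr_ge0 ?ler0n.
by rewrite !up_vp; have := vp_decr y; lra.
Qed.

Lemma expr_up_nondecr k : nondecr 1 (fun y => up y ^+ k).
Proof.
elim: k => [|k IHk]; first exact: nondecr1.
move=> y le1y; rewrite !exprS.
by apply: (nondecrM (incrW (incr_from (leq0n 1) up_incr)) IHk).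
Qed.

Lemma expr_up_incr k : (0 < k)%N -> incr 1 (fun y => up y ^+ k).
Proof.
case: k => // k _ y le1y; rewrite !exprSr.
exact: (nondecr_incrM (expr_up_nondecr k) (incr_from (leq0n 1) up_incr)).
Qed.

(** Convexity of the power function: of two intervals of equal length, the one further to the right
    has the larger increment. *)
Lemma ler_subX_shift (a b c d : rat) m : 0 <= d -> d < c -> c <= b -> a - b = c - d ->
  c ^+ m - d ^+ m <= a ^+ m - b ^+ m.
Proof.
move=> d0 lt_dc le_cb eq_abcd; elim: m => [|m IHm]; first by rewrite !subrr.
have -> : a ^+ m.+1 - b ^+ m.+1 = a * (a ^+ m - b ^+ m) + b ^+ m * (c - d).
  by rewrite -eq_abcd !exprS; ring.
have -> : c ^+ m.+1 - d ^+ m.+1 = c * (c ^+ m - d ^+ m) + d ^+ m * (c - d).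
  by rewrite !exprS; ring.
have dc : d ^+ m <= c ^+ m by apply: lerXn2r; rewrite ?nnegrE; lra.
have db : d ^+ m <= b ^+ m by apply: lerXn2r; rewrite ?nnegrE; lra.
apply: lerD; last by rewrite ler_wpM2r //; lra.
by apply: ler_pM => //; lra.
Qed.

Lemma ltr_subX_shift (a b c d : rat) m : 0 <= d -> d < c -> c <= b -> a - b = c - d ->
  (1 < m)%N -> c ^+ m - d ^+ m < a ^+ m - b ^+ m.
Proof.
move=> d0 lt_dc le_cb eq_abcd; case: m => // m m_gt0.
have -> : a ^+ m.+1 - b ^+ m.+1 = a * (a ^+ m - b ^+ m) + b ^+ m * (c - d).
  by rewrite -eq_abcd !exprS; ring.
have -> : c ^+ m.+1 - d ^+ m.+1 = c * (c ^+ m - d ^+ m) + d ^+ m * (c - d).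
  by rewrite !exprS; ring.
have dc : d ^+ m < c ^+ m by rewrite ltrXn2r // -lt0n.
have db : d ^+ m <= b ^+ m by apply: lerXn2r; rewrite ?nnegrE; lra.
have IHm := ler_subX_shift m d0 lt_dc le_cb eq_abcd.
apply: ltr_leD; last by rewrite ler_wpM2r //; lra.
apply: le_lt_trans (_ : c * (a ^+ m - b ^+ m) < _).
  by rewrite ler_wpM2l //; lra.
by rewrite ltr_pM2r //; lra.
Qed.

(** Times [up y], this is the factor of the cycle with [m.+1] vertices. *)
Definition wheel m y : rat := up y ^+ m - (- vp y) ^+ m.

Lemma exprN_odd (x : rat) m : (- x) ^+ m = if odd m then - x ^+ m else x ^+ m.
Proof. by rewrite exprNn -signr_odd; case: (odd m); rewrite ?mulN1r ?mul1r. Qed.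

Lemma wheel_incr m : (1 < m)%N -> incr 1 (wheel m).
Proof.
move=> m_gt1 y y_gt0; have v0 := vp_gt0 y; have v1 := vp_gt0 y.+1.
have v2 := vp_decr y; have v3 := vp_le y_gt0.
have vv : vp y.+1 ^+ m < vp y ^+ m by rewrite ltrXn2r ?(ltW v1) // -lt0n ltnW.
have uv : vp y ^+ m <= up y ^+ m.
  by apply: lerXn2r; rewrite ?nnegrE ?up_vp; lra.
have vm : 0 < vp y ^+ m by rewrite exprn_gt0.
rewrite /wheel !exprN_odd; case: ifP => _; split; try lra.
  have eu := up_vp y; have eu1 := up_vp y.+1.
  (* For odd [m] the two powers are added. As u + v = 1, u gains what v loses, and v <= u for
     [y >= 1], so convexity makes the gain prevail. *)
  have h : vp y ^+ m - vp y.+1 ^+ m < up y.+1 ^+ m - up y ^+ m.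
    by apply: ltr_subX_shift => //; lra.
  lra.
have uu : up y ^+ m < up y.+1 ^+ m.
  by have [u0 u1] := up_incr (leq0n y); rewrite ltrXn2r // -lt0n ltnW.
lra.
Qed.

Lemma factor_incr c : valid_factor c -> incr 1 (factor c).
Proof.
case: c => -[] l /andP[/= l2 l3]; rewrite /factor /=; last first.
  by apply: expr_up_incr; lia.
apply: (nondecr_incrM (incrW (incr_from (leq0n 1) up_incr))).
by apply: wheel_incr; lia.
Qed.

Lemma prod_factor_nondecr cs : all valid_factor cs ->
  nondecr 1 (fun y => \prod_(c <- cs) factor c y).
Proof.
elim: cs => [_ | c cs IHcs /= /andP[c_valid cs_valid]] y le1y;
  rewrite ?big_nil ?big_cons.
  exact: (nondecr1 le1y).
exact: (nondecrM (incrW (factor_incr c_valid)) (IHcs cs_valid)).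
Qed.

Lemma prod_factor_incr cs : all valid_factor cs -> cs != [::] ->
  incr 1 (fun y => \prod_(c <- cs) factor c y).
Proof.
case: cs => //= c cs /andP[c_valid cs_valid] _ y le1y.
rewrite !big_cons ![factor c _ * _]mulrC.
exact: (nondecr_incrM (prod_factor_nondecr cs_valid) (factor_incr c_valid)).
Qed.

(** The factor [up y] is that of an edge. A component with at least three vertices still increases
    strictly after division by it. *)
Lemma long_factor_incr c cs : (2 < c.2)%N -> all valid_factor cs ->
  exists2 rho, incr 1 rho &
    forall y, \prod_(d <- c :: cs) factor d y = up y * rho y.
Proof.
case: c => b l /= lt2l cs_valid.
have [h h_incr hE] : exists2 h, incr 1 h & forall y, factor (b, l) y = up y * h y.
  case: b; rewrite /factor /=.
    by exists (wheel l.-1) => //; apply: wheel_incr; lia.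
  exists (fun y => up y ^+ l.-2); first by apply: expr_up_incr; lia.
  by move=> y; rewrite -exprS; congr (_ ^+ _); lia.
exists (fun y => (\prod_(d <- cs) factor d y) * h y).
  exact: (nondecr_incrM (prod_factor_nondecr cs_valid) h_incr).
by move=> y; rewrite big_cons hE; ring.
Qed.

(** The factor of the cycle with [2 * k + 3] vertices divided by that of the triangle. As u + v = 1,
    it is the sum of [u ^ (2 i) * v ^ (2 (k - i))] over [i <= k]. *)
Fixpoint odd_cycle_quot k y : rat :=
  if k is k'.+1 then up y ^+ 2 * odd_cycle_quot k' y + vp y ^+ (2 * k) else 1.

Lemma wheel_even k y : wheel (2 * k.+1) y = (up y - vp y) * odd_cycle_quot k y.
Proof.
rewrite /wheel exprN_odd oddM /=.
elim: k => [|k IHk]; first by rewrite muln1 mulr1 up_vp; ring.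
rewrite /= mulrDr mulrCA -IHk !mulnS !exprD up_vp; ring.
Qed.

Lemma odd_cycle_quot_ge k y : vp y ^+ (2 * k) <= odd_cycle_quot k y.
Proof.
elim: k => [|k IHk] //=; rewrite lerDr mulr_ge0 ?sqr_ge0 //.
by rewrite (le_trans _ IHk) // exprn_ge0 // ltW ?vp_gt0.
Qed.

(** With [vp y.+1 = v / (1 + v)] this reduces to [2 v ^ 2 + 2 v <= 1], true for [v <= 1 / 3] but
    false at [v = 1 / 2]; hence the start at [y = 2]. *)
Lemma up_sq_gap y : (1 < y)%N -> vp y ^+ 2 <= up y.+1 ^+ 2 - up y ^+ 2.
Proof.
move=> y_gt1; rewrite !up_vp.
have v0 := vp_gt0 y; have v1 := vp_gt0 y.+1.
have e0 : vp y * (y%:R + 1) = 1 by rewrite natr1 mulVf // pnatr_eq0.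
have e1 : vp y.+1 * (y%:R + 2) = 1.
  have -> : y%:R + 2 = y.+2%:R :> rat by rewrite -[y.+2]addn2 natrD.
  by rewrite mulVf // pnatr_eq0.
have v_le : vp y <= 1 / 3.
  by rewrite mul1r lef_pV2 ?posrE ?ltr0n // ler_nat.
have -> : vp y.+1 = vp y / (1 + vp y).
  have vy : 1 + vp y != 0 by rewrite gt_eqF //; lra.
  apply: (mulIf vy); rewrite divfK //.
  have y2 : y%:R + 2 != 0 :> rat by rewrite gt_eqF // ltr_wpDl.
  have y1 : y%:R + 1 != 0 :> rat by rewrite gt_eqF // ltr_wpDl.
  have -> : vp y = 1 / (y%:R + 1) by exact: canRL (mulfK y1) e0.
  have -> : vp y.+1 = 1 / (y%:R + 2) by exact: canRL (mulfK y2) e1.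
  by field; rewrite y1 y2.
set v := vp y in v0 v_le *.
have v1_gt0 : 0 < 1 + v by lra.
have -> : (1 - v / (1 + v)) ^+ 2 = 1 / (1 + v) ^+ 2 by field; rewrite gt_eqF.
rewrite lerBrDr ler_pdivlMr ?exprn_gt0 //.
have -> : (v ^+ 2 + (1 - v) ^+ 2) * (1 + v) ^+ 2
   = 1 + v ^+ 2 * (2 * v ^+ 2 + 2 * v - 1) by ring.
have : v ^+ 2 * (2 * v ^+ 2 + 2 * v - 1) <= 0.
  by rewrite mulr_ge0_le0 ?sqr_ge0 //; nra.
lra.
Qed.

(** The growth of u squared, multiplied by the quotient for [k], already makes up for the whole term
    [vp y ^+ (2 * k.+1)]. The new power of v is positive and gives strictness. *)
Lemma odd_cycle_quot_step k :
  nondecr 2 (odd_cycle_quot k) -> incr 2 (odd_cycle_quot k.+1).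
Proof.
move=> k_nd y lt1y; have [g0 g1 g2] := k_nd y lt1y.
have vk : 0 < vp y ^+ (2 * k) by rewrite exprn_gt0 ?vp_gt0.
have vk' : 0 < vp y.+1 ^+ (2 * k.+1) by rewrite exprn_gt0 ?vp_gt0.
have ge := odd_cycle_quot_ge k y; have gap := up_sq_gap lt1y.
have E z : odd_cycle_quot k.+1 z
    = up z ^+ 2 * odd_cycle_quot k z + vp z ^+ (2 * k.+1) by [].
rewrite !{}E; split.
  apply: addr_ge0; first by apply: mulr_ge0 => //; apply: sqr_ge0.
  by rewrite exprn_ge0 // ltW ?vp_gt0.
have -> : vp y ^+ (2 * k.+1) = vp y ^+ 2 * vp y ^+ (2 * k) by rewrite mulnS exprD.
move: (odd_cycle_quot k y) (odd_cycle_quot k y.+1) g0 g1 g2 ge => g g' g0 g1 g2 ge.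
move: (vp y ^+ (2 * k)) (vp y.+1 ^+ (2 * k.+1)) vk vk' ge => V V' V0 V'0 ge.
have h1 : up y.+1 ^+ 2 * g <= up y.+1 ^+ 2 * g' by rewrite ler_wpM2l ?sqr_ge0.
have gap0 : 0 <= up y.+1 ^+ 2 - up y ^+ 2 by rewrite (le_trans _ gap) ?sqr_ge0.
have h2 : vp y ^+ 2 * V <= (up y.+1 ^+ 2 - up y ^+ 2) * g.
  by apply: ler_pM => //; rewrite ?sqr_ge0 // ltW.
lra.
Qed.

Lemma odd_cycle_quot_nondecr k : nondecr 2 (odd_cycle_quot k).
Proof.
elim: k => [|k IHk]; first exact: nondecr1.
exact/incrW/odd_cycle_quot_step.
Qed.

(** A zero at [y = 1], that is, with two colors, reveals an odd cycle, from which the factor of the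
    triangle is extracted. *)
Lemma odd_cycle_incr cs :
    all valid_factor cs -> \prod_(c <- cs) factor c 1 = 0 -> cs != [:: (true, 3)] ->
  exists2 rho, incr 2 rho &
    forall y, \prod_(c <- cs) factor c y = up y * (up y - vp y) * rho y.
Proof.
move=> cs_valid /eqP; rewrite prodf_seq_eq0 => /hasP[[b l] c_cs /= c0].
have [k [b1 lE]] : exists k, b /\ l = (2 * k.+1).+1.
  have c_valid := allP cs_valid _ c_cs; move: c0 c_valid;
    rewrite /factor /valid_factor /=.
  (* At [y = 1] both are 1/2, so among valid factors only a cycle with [l - 1] even vanishes. *)
  have up1 : up 1 = vp 1 by rewrite /up mul1r.
  have v0 := vp_gt0 1.
  have vn n : vp 1 ^+ n != 0 by rewrite expf_neq0 // gt_eqF.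
  case: b {c_cs} => /=; last by rewrite up1 (negPf (vn _)).
  rewrite mulf_eq0 up1 (gt_eqF v0) /= exprN_odd; case: ifP => l_odd.
    by rewrite opprK -mulr2n mulrn_eq0 /= (negPf (vn _)).
  move=> _ /andP[l_gt1 l_gt2]; exists (l.-1./2).-1; split=> //; lia.
move: c_cs; rewrite {b}b1 {l}lE in c0 * => c_cs cs_neq.
set c := (true, _) in c0 c_cs; pose rest := rem c cs.
have perm_cs : perm_eq cs (c :: rest) := perm_to_rem c_cs.
have rest_valid : all valid_factor rest.
  by apply/allP => d /mem_rem; apply: (allP cs_valid).
exists (fun y => (\prod_(d <- rest) factor d y) * odd_cycle_quot k y); last first.
  move=> y; rewrite (perm_big _ perm_cs) big_cons {1}/factor /= -/(wheel _ _)
    wheel_even.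
  by ring.
(* If the odd cycle is a triangle, strictness comes from another component; otherwise from the
   quotient itself. *)
case: k @c c0 @rest c_cs perm_cs rest_valid => [|k] c c0 rest c_cs perm_cs rest_valid.
  have rest_neq : rest != [::].
    apply: contraNneq cs_neq => rest0; rewrite rest0 in perm_cs.
    by apply/eqP/perm_small_eq.
  move=> y le2y; rewrite -[odd_cycle_quot 0 y]/1 -[odd_cycle_quot 0 _]/1 !mulr1.
  exact: (prod_factor_incr rest_valid rest_neq (ltnW le2y)).
have rest_nd := nondecr_from (leqnSn 1) (prod_factor_nondecr rest_valid).
exact: (nondecr_incrM rest_nd (odd_cycle_quot_step (odd_cycle_quot_nondecr k))).
Qed.

End Monotonicity.

(** * The extremal graph *)

Section Isomorphism.

Lemma num_proper_isomorphic (G H : sgraph) x : isomorphic G H ->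
  num_proper (@edge G) x = num_proper (@edge H) x.
Proof.
move=> [f [g fK gK] f_mono].
pose pull (c : {ffun H -> 'I_x}) : {ffun G -> 'I_x} := [ffun v => c (f v)].
pose push (c : {ffun G -> 'I_x}) : {ffun H -> 'I_x} := [ffun v => c (g v)].
have pull_bij : bijective pull.
  by exists push => c; apply/ffunP=> v; rewrite !ffunE ?fK ?gK.
rewrite /num_proper -(on_card_preimset (onW_bij _ pull_bij)); apply: eq_card => c.
rewrite !inE; apply/forallP/forallP => c_proper a; apply/forallP => b; apply/implyP.
  have /forallP/(_ (g b))/implyP := c_proper (g a).
  by rewrite !ffunE -f_mono !gK.
have /forallP/(_ (f b))/implyP := c_proper (f a).
by rewrite !ffunE f_mono.
Qed.

Definition clique_plus k p := disjoint_union (complete k) (isolated p).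

Lemma card_clique_plus k p : #|clique_plus k p| = k + p.
Proof. by rewrite card_sum !card_ord. Qed.

Lemma num_proper_clique_plus k p x :
  num_proper (@edge (clique_plus k p)) x = x ^_ k * x ^ p.
Proof.
have -> : x ^_ k = #|[set h : {ffun 'I_k -> 'I_x} | injectiveb h]|.
  by rewrite card_inj_ffuns !card_ord.
have -> : x ^ p = #|[set: {ffun 'I_p -> 'I_x}]| by rewrite cardsT card_ffun !card_ord.
rewrite -cardsX.
pose split (f : {ffun clique_plus k p -> 'I_x}) :=
  ([ffun i => f (inl i)] : {ffun 'I_k -> 'I_x}, [ffun j =>
    f (inr j)] : {ffun 'I_p -> 'I_x}).
pose glue (h : {ffun 'I_k -> 'I_x} * {ffun 'I_p -> 'I_x}) : {ffun clique_plus k p ->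
  'I_x} :=
  [ffun v => match v with inl i => h.1 i | inr j => h.2 j end].
have split_bij : bijective split.
  exists glue => [f | [h1 h2]].
    by apply/ffunP => -[i|j]; rewrite !ffunE.
  by congr (_, _); apply/ffunP => i; rewrite !ffunE.
rewrite -(on_card_preimset (onW_bij _ split_bij)); apply: eq_card => f.
rewrite !inE andbT /=; apply/forallP/injectiveP => [f_proper i j | f_inj u].
  rewrite !ffunE => /eqP eq_f; apply/eqP.
  have /forallP/(_ (inl j)) := f_proper (inl i).
  by rewrite eq_f /= /complete_edge implybF negbK.
apply/forallP => w; apply/implyP; case: u w => [i|i] [j|j] //=.
rewrite /complete_edge; apply: contraNneq => eq_f.
by apply/eqP/f_inj; rewrite !ffunE.
Qed.

Lemma isomorphic_clique_plus (G : sgraph) (t : seq G) : uniq t ->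
    (forall a b : G, edge a b = [&& a \in t, b \in t & a != b]) ->
  isomorphic G (clique_plus (size t) (#|G| - size t)).
Proof.
move=> t_uniq edgeE.
case: (posnP #|G|) => [G0 | /card_gt0P[v0 _]].
  have t0 : t = [::] by case: t t_uniq edgeE => // a t; have := fintype0 a G0.
  have noG (x : G) : False by exact: (fintype0 x G0).
  have noH (u : clique_plus (size t) (#|G| - size t)) : False.
    by case: u => -[i]; rewrite ?G0 t0.
  exists (fun x : G => False_rect _ (noG x)); last by move=> x; case: (noG x).
  by exists (fun u => False_rect _ (noH u)) => x; [case: (noG x) | case: (noH x)].
pose r := [seq a <- enum G | a \notin t].
have r_uniq : uniq r by rewrite filter_uniq ?enum_uniq.
have size_r : size r = #|G| - size t.
  have -> : size t = count (mem t) (enum G).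
    rewrite -size_filter; apply/esym/perm_size/uniq_perm => //.
      by rewrite filter_uniq ?enum_uniq.
    by move=> a; rewrite mem_filter mem_enum andbT.
  by rewrite size_filter cardE -(count_predC (mem t)) addKn.
have mem_r a : (a \in r) = (a \notin t) by rewrite mem_filter mem_enum andbT.
pose h (u : clique_plus (size t) (#|G| - size t)) : G :=
  match u with inl i => nth v0 t i | inr j => nth v0 r j end.
have h_inl i : h (inl i) \in t by rewrite mem_nth.
have h_inr j : h (inr j) \notin t by rewrite -mem_r mem_nth // size_r.
have h_inj : injective h.
  move=> [i|i] [j|j] eq_h.
  - by congr inl; apply/val_inj/eqP;
    rewrite -(nth_uniq v0 _ _ t_uniq) ?ltn_ord // (eq_h : nth _ _ _ = _).
  - by have := h_inl i; rewrite eq_h (negPf (h_inr j)).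
  - by have := h_inl j; rewrite -eq_h (negPf (h_inr i)).
  - by congr inr; apply/val_inj/eqP;
    rewrite -(nth_uniq v0 _ _ r_uniq) ?size_r ?ltn_ord // (eq_h : nth _ _ _ = _).
have [|f hK fK] := inj_card_bij h_inj.
  by rewrite card_clique_plus subnKC // -(card_uniqP t_uniq) max_card.
exists f; first by exists h.
move=> a b; rewrite -{2}(fK a) -{2}(fK b) edgeE (inj_eq h_inj).
case: (f a) (f b) => [i|i] [j|j].
- by rewrite !h_inl /= /complete_edge.
- by rewrite (negPf (h_inr j)) andbF.
- by rewrite (negPf (h_inr i)).
- by rewrite (negPf (h_inr i)).
Qed.

End Isomorphism.

(** * Case distinction on the chromatic number *)

Section Assembly.
Variables (G : sgraph) (n : nat).
Hypotheses (order_G : #|G| = n) (max_degree_G : max_degree G = 2).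

Local Notation density := (proper_density (@edge G)).

Lemma max_degree_le v : #|[set w : G | edge v w]| <= 2.
Proof. by rewrite -max_degree_G; apply: (leq_bigmax (F := @degree G)). Qed.

Lemma ex_path3 : exists b a c : G, uniq [:: b; a; c] /\ path (@edge G) b [:: a; c].
Proof.
have [v deg_v] : exists v : G, 1 < #|[set w | edge v w]|.
  apply/existsP; apply: contraT; rewrite negb_exists => /forallP deg1.
  have : max_degree G <= 1.
    by apply/bigmax_leqP => v _; rewrite leqNgt; apply: deg1.
  by rewrite max_degree_G.
have /card_gt1P[b [c [vb vc b_c]]] := deg_v; rewrite !inE in vb vc.
exists b, v, c; rewrite /= edge_sym vb vc !inE negb_or b_c !andbT; split=> //.
apply/andP; split.
  by apply: contraTneq vb => ->; rewrite edge_irrefl.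
by apply: contraTneq vc => ->; rewrite edge_irrefl.
Qed.

Lemma order_ge3 : 2 < n.
Proof.
have [b [a [c [u _]]]] := ex_path3.
by rewrite -order_G -(card_uniqP u : #|[:: b; a; c]| = 3) max_card.
Qed.

Lemma colorable_density y : colorable G y.+1 = (0 < density y)%R.
Proof.
rewrite /proper_density pmulr_lgt0 ?invr_gt0 ?exprn_gt0 ?ltr0n //.
apply/existsP/card_gt0P => -[f f_proper]; exists f; first by rewrite inE.
by rewrite inE in f_proper.
Qed.

Lemma num_proper_eq0 x : x < chromatic_number G -> num_proper (@edge G) x = 0.
Proof.
rewrite /chromatic_number; case: ex_minnP => k _ min_k lt_xk.
apply/eqP; apply: contraLR lt_xk; rewrite -lt0n -leqNgt => /card_gt0P[f].
by rewrite inE => f_proper; apply: min_k; apply/existsP; exists f.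
Qed.

(** The fraction before [rho] is the density of the clique with isolated vertices, so [rho y] is the
    quotient of the chromatic polynomials at [x = y + 1]; [y >= k - 1] means [x >= k]. *)
Lemma lt_average_clique_plus k (rho : nat -> rat) :
    chromatic_number G = k -> 0 < k <= n -> incr k.-1 rho ->
    (forall y, (k.-1 <= y)%N ->
       density y = (y.+1 ^_ k)%:R / y.+1%:R ^+ k * rho y)%R ->
  (average (clique_plus k (n - k)) < average G)%R.
Proof.
move=> chi_G /andP[k_gt0 le_kn] rho_incr densityE.
have n_gt2 := order_ge3.
pose H := clique_plus k (n - k).
have qE x : num_proper (@edge H) x = x ^_ k * x ^ (n - k).
  exact: num_proper_clique_plus.
have pred_le x : k <= x -> k.-1 <= x.-1 /\ x.-1.+1 = x by lia.
apply: (@lt_average G H _ _ (fun x => rho x.-1) k).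
- by rewrite order_G; lia.
- by rewrite card_clique_plus; lia.
- by move=> x lt_xk; rewrite num_proper_eq0 ?chi_G // qE ffact_small.
- move=> x le_kx; rewrite ltr0n qE muln_gt0 ffact_gt0 le_kx expn_gt0.
  by rewrite (leq_trans k_gt0).
- move=> x /[dup] le_kx /pred_le[le_y eq_x].
  have := densityE _ le_y; rewrite /proper_density eq_x order_G => E.
  have x0 : (x%:R != 0 :> rat)%R by rewrite pnatr_eq0; lia.
  move/(canRL (mulfVK (expf_neq0 n x0))): E => ->.
  rewrite qE natrM natrX -{1}(subnKC le_kn) exprD; field.
  by rewrite expf_neq0.
- by move=> x /pred_le[/rho_incr[]].
- by move=> x /pred_le[le_y {2}<-]; have [_] := rho_incr _ le_y.
Qed.

Lemma lt_average_or_isomorphic :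
  let H := clique_plus (chromatic_number G) (n - chromatic_number G) in
  (average H < average G)%R \/ isomorphic G H.
Proof.
have n_gt2 := order_ge3.
have [b [a [c [uniq0 path0]]]] := ex_path3.
have edge_ba : edge b a by case/andP: path0.
(* The first component is taken around a vertex of degree 2 or better, so that it has at least three
   vertices and its edges remain known explicitly. *)
have [v [s [t_uniq t_path lt_1s closed densityE]]] :=
  ex_component (@edge_sym G) (@edge_irrefl G) max_degree_le uniq0 path0.
have [cs [cs_valid csE cs_nil]] := ex_factors (edges_off_sym (v :: s) (@edge_sym G))
  (edges_off_irr (v :: s) (@edge_irrefl G)) (edges_off_deg (v :: s) max_degree_le).
pose b0 := (1 < size s) && edge v (last v s); pose fac := (b0, (size s).+1).
have fac_long : 2 < fac.2 by [].
have fac_valid : valid_factor fac.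
  by rewrite /valid_factor /= ltnW // fac_long implybT.
have prodE y : density y = (\prod_(d <- fac :: cs) factor d y)%R.
  by rewrite big_cons densityE csE.
have all_valid : all valid_factor (fac :: cs) by rewrite /= fac_valid.
have chi_gt1 : 1 < chromatic_number G.
  rewrite /chromatic_number; case: ex_minnP => k /existsP[f f_proper] _.
  have := f_proper => /forallP/(_ b)/forallP/(_ a); rewrite edge_ba /=.
  case: k f f_proper => [|[|k]] // f _; first by case: (f b).
  by rewrite !ord1.
have min_chi k : colorable G k -> chromatic_number G <= k.
  by rewrite /chromatic_number; case: ex_minnP => m _; apply.
(* At [y = 2], that is, with three colors, every factor is positive. *)
have chi_le3 : chromatic_number G <= 3.
  apply: min_chi; rewrite colorable_density prodE.
  by have [] := prod_factor_nondecr all_valid (leqnn 1).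
have [chi2 | chi3] : chromatic_number G = 2 \/ chromatic_number G = 3 by lia.
  rewrite chi2 /=; left; have [rho rho_incr rhoE] := long_factor_incr fac_long cs_valid.
  apply: (lt_average_clique_plus chi2 _ rho_incr) => [|y _]; first by lia.
  rewrite prodE rhoE; congr (_ * _)%R.
  rewrite ffactnS ffactn1 natrM /up; field.
  by rewrite addrC natr1 pnatr_eq0.
rewrite chi3 /=.
case: (eqVneq (fac :: cs) [:: (true, 3)]) => [[closing size_s cs0] | not_triangle].
  (* No edge is left off the triangle [v :: s]. *)
  right; have e0 := cs_nil cs0.
  rewrite -chi3; have <- : size (v :: s) = chromatic_number G by rewrite chi3 /= size_s.
  rewrite -order_G; apply: isomorphic_clique_plus => // x y.
  move: closing => /andP[_]; case: s t_uniq t_path size_s closed e0 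
    {prodE all_valid fac_long fac_valid fac b0 densityE cs csE cs_nil cs_valid cs0
      lt_1s} => [|w [|z []]] //=.
  move=> t_uniq /and3P[vw wz _] _ closed e0 vz.
  have in_t : edge x y -> (x \in [:: v; w; z]) && (y \in [:: v; w; z]).
    move=> xy; rewrite -(closed _ _ xy) andbb; apply: contraFT (e0 x y) => x_t.
    by rewrite /edges_off /= xy x_t -(closed _ _ xy).
  apply/idP/and3P => [xy | [xt yt x_y]].
    have /andP[-> ->] := in_t xy; split=> //.
    by apply: contraTneq xy => ->; rewrite edge_irrefl.
  move: x_y xt yt; rewrite !inE => x_y /or3P[] /eqP xE /or3P[] /eqP yE;
    by move: x_y; rewrite xE yE ?eqxx // edge_sym.
left.
(* Otherwise two colors would suffice. *)
have prod1 : (\prod_(d <- fac :: cs) factor d 1 = 0)%R.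
  apply/eqP; rewrite -prodE; apply: contraT => d1.
  have : colorable G 2.
    rewrite colorable_density lt_def d1 prodE /=.
    by have [] := prod_factor_nondecr all_valid (leqnn 1).
  by move/min_chi; rewrite chi3.
have [rho rho_incr rhoE] := odd_cycle_incr all_valid prod1 not_triangle.
apply: (lt_average_clique_plus chi3 _ rho_incr) => // y lt_1y.
rewrite prodE rhoE; congr (_ * _)%R.
rewrite !ffactnS ffactn0 muln1 /= !natrM -[y.-1]subn1 natrB 1?ltnW // /up /vp; field.
by rewrite addrC natr1 pnatr_eq0.
Qed.

End Assembly.

Theorem theorem26 (G : sgraph) (n : nat)
    (order_G : #|G| = n) (max_degree_G : max_degree G = 2) :
  let H := disjoint_union (complete (chromatic_number G))
                          (isolated (n - chromatic_number G)) in
  (average H <= average G)%R /\ (average G = average H <-> isomorphic G H).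
Proof.
move=> H; have n_gt2 := order_ge3 order_G max_degree_G.
have avg_iso : isomorphic G H -> average G = average H.
  move=> G_H; apply: eq_average => [||x].
  - by rewrite order_G; lia.
  - by rewrite card_clique_plus; lia.
  - by rewrite (num_proper_isomorphic _ G_H).
case: (lt_average_or_isomorphic order_G max_degree_G) => [lt_HG | G_H].
  split; first exact: ltW.
  by split=> // eq_GH; rewrite eq_GH ltxx in lt_HG.
by split; [rewrite (avg_iso G_H) | split].
Qed.
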